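(* Let $N,d\ge 1$ be integers. For $j,k=1,\dots,N$ let $u_{jk},u_{jk}^{*}:[0,+\infty)\to[0,+\infty)$ be Lebesgue integrable on compact intervals. Let $(t_n)_{n\in\mathbb N}\subset[0,+\infty)$ be a sequence with $t_n\to+\infty$ such that, for each $j,k=1,\dots,N$, the functions $t\mapsto u_{jk}(t_n+t)$ satisfy $u_{jk}(t_n+\cdot)\overset{\ast}{\rightharpoonup}u_{jk}^{*}$ as $n\to\infty$. Let $G$ be the directed graph with nodes $\{1,\dots,N\}$ in which there is an arrow from node $j$ to node $k$ if $$\int_{0}^{+\infty}u_{jk}^{*}(s)\,ds>0 .$$ Assume that for each pair of distinct nodes $j\neq k$ there is at least one arrow from $j$ to $k$ or from $k$ to $j$. Then, for every initial configuration $(x_1(0),\dots,x_N(0))\in(\mathbb R^d)^N$, the solution of $$\dot x_j=\sum_{k=1}^{N}u_{jk}(t)\,(x_k-x_j),\qquad j=1,\dots,N,$$ converges to consensus.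
   Context: Convergence $\overset{\ast}{\rightharpoonup}$: for $f_n,f:[0,+\infty)\to[0,+\infty)$ Lebesgue integrable on compact intervals, $f_n\overset{\ast}{\rightharpoonup}f$ means $\lim_{n\to\infty}\int_a^b f_n=\int_a^b f$ for all bounded intervals $[a,b]\subset[0,+\infty)$. Solutions are in the Carathéodory sense: $x_j:[0,+\infty)\to\mathbb R^d$ is absolutely continuous on compact intervals and the equation holds for almost every $t$. Consensus: a solution converges to consensus if there exists $x^*\in\mathbb R^d$ with $\lim_{t\to+\infty}x_j(t)=x^*$ for all $j=1,\dots,N$. *)

(* Defs.v *)
From HB Require Import structures.
From mathcomp Require Import all_boot all_order all_algebra.
From mathcomp Require Import all_classical all_reals all_analysis.

Set Implicit Arguments.
Unset Strict Implicit.
Unset Printing Implicit Defensive.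

Import Order.TTheory GRing.Theory Num.Theory.
Import numFieldNormedType.Exports.

Local Open Scope classical_set_scope.
Local Open Scope ring_scope.

(* Functions on [0, +oo) are represented by total functions on R of which only
   the values at nonnegative points are ever used.  All integrals are taken with
   respect to [completed_lebesgue_measure], because the library's
   [lebesgue_measure] only measures Borel sets: with the latter, [integrable]
   would exclude the Lebesgue integrable functions that are not Borel. *)

Definition integrable_on_compacts (R : realType) (f : R -> R) : Prop :=
  forall a b : R, 0 <= a -> a <= b ->
    (@completed_lebesgue_measure R).-integrable `[a, b] (EFin \o f).

Definition weak_star_cvg (R : realType) (f_ : nat -> R -> R) (f : R -> R) :
    Prop :=
  forall a b : R, 0 <= a -> a <= b ->
    \int[@completed_lebesgue_measure R]_(s in `[a, b]) f_ n s @[n --> \oo] -->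
    \int[@completed_lebesgue_measure R]_(s in `[a, b]) f s.

(* The intervals may be degenerate and may share endpoints. *)
Definition absolutely_continuous (R : realType) (V : normedModType R)
    (a b : R) (f : R -> V) : Prop :=
  forall e : R, 0 < e -> exists2 delta : R, 0 < delta &
    forall (n : nat) (l r : 'I_n -> R),
      (forall i, [/\ a <= l i, l i <= r i & r i <= b]) ->
      (forall i j, i != j -> `]l i, r i[ `&` `]l j, r j[ = set0) ->
      \sum_(i < n) (r i - l i) < delta ->
      \sum_(i < n) `|f (r i) - f (l i)| < e.

(* The differential equation is required at almost every t > 0 and not at t = 0,
   where a two-sided derivative would involve values of x outside [0, +oo). *)
Definition caratheodory_solution (R : realType) (N d : nat)
    (u : 'I_N -> 'I_N -> R -> R) (x : 'I_N -> R -> 'rV[R]_d) : Prop :=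
  forall j : 'I_N,
    (forall a b : R, 0 <= a -> a <= b -> absolutely_continuous a b (x j)) /\
    {ae @completed_lebesgue_measure R, forall t : R, 0 < t ->
      is_derive t 1 (x j) (\sum_(k < N) u j k t *: (x k t - x j t))}.

(* The integral is extended-real valued: it may be +oo. *)
Definition arrow (R : realType) (N : nat) (u : 'I_N -> 'I_N -> R -> R)
    (j k : 'I_N) : Prop :=
  (0 < \int[@completed_lebesgue_measure R]_(s in `[0%R : R, +oo[) (u j k s)%:E)%E.

Definition converges_to_consensus (R : realType) (N d : nat)
    (x : 'I_N -> R -> 'rV[R]_d) : Prop :=
  exists xstar : 'rV[R]_d, forall j : 'I_N, x j t @[t --> +oo] --> xstar.

(* Main.v *)
(* Coordinatewise, a solution y satisfies a maximum and a minimum principle, so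
   max_j y_j decreases to some M and min_j y_j increases to some m.  Suppose
   m < M.  On a late window [t_n, t_n + T], all y_l lie in [m - e, M + e], the
   total weight is at most K, and every pair of nodes interacts one way or the
   other with weight at least c, by weak-star convergence and semicompleteness.
   Some y_j is at least M at the end of the window; by Gronwall run backwards it
   was within e * exp K of M + e during the whole window.  Likewise some y_k
   stayed near m.  An arrow from j to k (or from k to j) then forces y_j to drop
   (or y_k to rise) by about c * (M - m), which is impossible for small e.

   Only integrals of u over windows enter, so no limit equation and no
   compactness is needed.  The differential inequalities are integrated through
   the fact that an absolutely continuous function whose upper right Dini
   derivative is nonpositive almost everywhere is nonincreasing; Dini
   derivatives are what makes it apply to max_j y_j.  Primitives of u are
   differentiated by replacing u with a Borel function, since the library's
   Lebesgue differentiation theorem is about Borel functions. *)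

Require Import Defs.
From HB Require Import structures.
From mathcomp Require Import all_boot all_order all_algebra.
From mathcomp Require Import all_classical all_reals all_analysis.
From mathcomp Require Import measurable_realfun ring lra.

Set Implicit Arguments.
Unset Strict Implicit.
Unset Printing Implicit Defensive.

Import Order.TTheory GRing.Theory Num.Theory.
Import numFieldNormedType.Exports.

Local Open Scope classical_set_scope.
Local Open Scope ring_scope.

(** * Borel versions of Lebesgue measurable functions, and translation invariance *)

Section borel.
Context {R : realType}.
Notation lmu := (@lebesgue_measure R).
Notation cmu := (@completed_lebesgue_measure R).
Notation completedR := (caratheodory_type (wlength (@idfun R))^*%mu).

(** Both sides mean that the outer measure of [N] vanishes; almost-everywhere statements thus pass
    between the two measures. *)
Lemma completed_negligible (N : set R) : cmu.-negligible N <-> lmu.-negligible N.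
Proof.
rewrite negligible_outer_measure; split.
  case=> A [mA A0 NA]; apply/eqP; rewrite eq_le outer_measure_ge0 andbT.
  by rewrite -[leRHS]A0 le_outer_measure.
move=> /negligible_outer_measure[A [mA A0 NA]]; exists A; split => //.
exact: sub_caratheodory.
Qed.

(** The Carathéodory sigma-algebra is the completion of the Borel one. *)
Lemma completed_measurableP (A : set R) :
  @measurable _ completedR A ->
  exists B N, [/\ measurable B, lmu.-negligible N & A = B `|` N].
Proof.
move=> mA; have : (wlength idfun)^*%mu.-cara.-measurable A by exact mA.
rewrite -completed_caratheodory_measurable g_sigma_completed_algebra_genE.
by move=> [B mB [N nN <-]]; exists B, N.
Qed.

Lemma measurable_id_completed :
  @measurable_fun _ _ completedR (measurableTypeR R) setT idfun.
Proof. by move=> _ A mA; rewrite setTI; exact: sub_caratheodory. Qed.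

(** The Borel measure is the pushforward of the completed one under the identity, so this is a
    change of variables. *)
Lemma ge0_integral_completed (D : set R) (g : R -> R) :
  measurable D -> measurable_fun D g -> (forall x, D x -> 0 <= g x) ->
  (\int[cmu]_(x in D) (g x)%:E = \int[lmu]_(x in D) (g x)%:E)%E.
Proof.
move=> mD mg g0.
have mg' : measurable_fun D (fun x => (g x)%:E) by exact/measurable_EFinP.
have g0' : {in D, forall y, (0 <= (g y)%:E)%E}.
  by move=> x /set_mem Dx; rewrite lee_fin g0.
by rewrite -(ge0_integral_pushforward measurable_id_completed cmu mD mg' g0').
Qed.

(* [g] is [f] set to [0] on a Borel null set [M] that contains the non-Borel
   parts of the countably many sets [f @^-1` `]q, +oo[] with [q] rational. *)
Lemma completed_borel_version (f : R -> R) :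
  @measurable_fun _ _ completedR R setT f ->
  (forall x, 0 <= f x) ->
  exists g : R -> R, [/\ measurable_fun setT g,
    forall x, 0 <= g x &
    exists2 M, lmu.-negligible M & forall x, ~ M x -> g x = f x].
Proof.
(* [q] runs through all rationals; indices that encode none are sent to 0. *)
move=> mf f0; pose q n : R := ratr (odflt 0%Q (unpickle n)).
have /choice[B /choice[N BN]] : forall n, exists B N,
    [/\ measurable B, lmu.-negligible N & f @^-1` `]q n, +oo[ = B `|` N].
  move=> n; apply: completed_measurableP.
  by rewrite -[_ @^-1` _]setTI; apply: mf => //; exact: measurable_itv.
have [M [mM M0 NM]] : lmu.-negligible (\bigcup_n N n).
  by apply: negligible_bigcup => n; have [] := BN n.
pose g := f \_ (~` M).
have gE x : ~ M x -> g x = f x by move=> Mx; rewrite /g patchE mem_set.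
have gM x : M x -> g x = 0 by move=> Mx; rewrite /g patchE memNset//; apply.
have g0 x : 0 <= g x by have [/gM->//|/gE->] := pselect (M x).
exists g; split => //; last by exists M => //; exists M; split.
move=> _; apply: (measurability _ (RGenOInfty.measurableE R)) => //.
move=> _ [_ [r ->] <-]; rewrite setTI.
(* On [M] the value is 0, hence the condition [r < 0]; off [M], [r < f x] holds exactly when some
   rational lies between them. *)
rewrite (_ : _ @^-1` _ = [set x | M x /\ r < 0] `|`
   \bigcup_n [set x | (B n x /\ ~ M x) /\ r < q n]).
  apply: measurableU.
    have [r0|r0] := ltP r 0.
      by rewrite (_ : [set _ | _] = M)//; apply/seteqP; split => // x [].
    by rewrite (_ : [set _ | _] = set0)//; apply/seteqP; split => // x [].
  apply: bigcupT_measurable => n; have [mB _ _] := BN n.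
  have [r0|r0] := ltP r (q n).
    rewrite (_ : [set _ | _] = B n `\` M); first exact: measurableD.
    by apply/seteqP; split => [x [[]]|x []].
  by rewrite (_ : [set _ | _] = set0)//; apply/seteqP; split => // x [].
apply/seteqP; split => x /=.
  rewrite in_itv/= andbT => rg.
  have [Mx|Mx] := pselect (M x); first by left; rewrite -(gM _ Mx).
  right; move: rg; rewrite gE// => rf; have [p] := rat_in_itvoo rf.
  rewrite in_itv/= => /andP[rp pf]; exists (pickle p) => //.
  have qp : q (pickle p) = ratr p by rewrite /q pickleK.
  have [_ _ /seteqP[+ _]] := BN (pickle p).
  move=> /(_ x); rewrite /= in_itv/= andbT qp => /(_ pf)[Bx|Nx].
    by split.
  by exfalso; apply/Mx/NM; exists (pickle p).
rewrite in_itv/= andbT => -[[Mx r0]|[n _ [[Bx Mx] rq]]]; first by rewrite gM.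
rewrite gE//; have [_ _ /seteqP[_ +]] := BN n.
move=> /(_ x); rewrite /= in_itv/= andbT => h; apply: (lt_trans rq); apply: h.
by left.
Qed.

(** The translated measure gives half-open intervals their length, which determines Lebesgue
    measure. *)
Lemma lebesgue_measure_translation (c : R) (A : set R) :
  measurable A -> lmu ((fun s => c + s) @^-1` A) = lmu A.
Proof.
move=> mA.
have mphi : @measurable_fun _ _ (measurableTypeR R) (measurableTypeR R) setT
    (fun s => c + s).
  exact: measurable_funD.
apply/esym; apply: (@lebesgue_measure_unique R (pushforward lmu
  (fun s : measurableTypeR R => (c + s) : measurableTypeR R))) => //.
move=> X /ocitvP[->|[[a b] /= ab ->]]; first by rewrite !measure0.
rewrite /pushforward (_ : _ @^-1` _ = `]a - c, b - c]%classic).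
  rewrite !lebesgue_measure_itv/= !lte_fin ltrD2r -!EFinB opprB.
  by rewrite addrA subrK.
by apply/seteqP; split => x /=; rewrite !in_itv/= ltrBlDl lerBrDl.
Qed.

(** Passes from a possibly non-Borel [f] to its Borel version [g]. Measurability of [f] on [D] comes
    from that of [g]: they differ only inside [M], all of whose subsets are measurable for the
    completed measure. *)
Lemma completed_ae_integral (D : set R) (f g : R -> R) (M : set R) :
  measurable D -> measurable_fun setT g -> (forall x, 0 <= g x) ->
  (forall x, D x -> 0 <= f x) ->
  lmu.-negligible M -> (forall x, D x -> ~ M x -> f x = g x) ->
  (\int[cmu]_(x in D) (f x)%:E = \int[lmu]_(x in D) (g x)%:E)%E.
Proof.
move=> mD mg g0 f0 nM fg.
rewrite -ge0_integral_completed//; last exact: measurable_funTS.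
have mDc : @measurable _ completedR D.
  exact: sub_caratheodory.
have mgc : @measurable_fun _ _ completedR R D g.
  apply: measurable_funTS => _ A mA; rewrite setTI; apply: sub_caratheodory.
  by rewrite -[_ @^-1` _]setTI; apply: mg.
have mfc : @measurable_fun _ _ completedR R D f.
  move=> _ A mA.
  have mS B : B `<=` M ->
      @measurable _ completedR B.
    move=> BM; have nB : lmu.-negligible B by exact: negligibleS nM.
    apply: negligible_sub_caratheodory.
    by have := (completed_negligible B).2 nB; exact.
  rewrite [X in measurable X](_ : _ =
    ((D `&` g @^-1` A) `\` (M `&` D `&` g @^-1` A)) `|` (M `&` (D `&` f @^-1` A))).
    apply: measurableU; last by apply: mS => x [].
    by apply: measurableD; [exact: mgc|apply: mS => x [[]]].
  apply/seteqP; split => x /=.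
    move=> [Dx fx]; have [Mx|Mx] := pselect (M x); first by right.
    by left; split; [rewrite -fg|case=> -[]].
  move=> [[[Dx gx] Mx]|[]//]; split => //.
  by rewrite fg// => Mx'; apply: Mx.
apply: ge0_ae_eq_integral.
- exact: mDc.
- exact/measurable_EFinP.
- exact/measurable_EFinP.
- by move=> x Dx; rewrite lee_fin f0.
- by move=> x Dx; rewrite lee_fin g0.
apply/completed_negligible; apply: (negligibleS _ nM) => x /=.
by move=> /not_implyP[Dx] h; apply: contrapT => Mx; apply/h; rewrite fg.
Qed.

Lemma ge0_integral_translation (c : R) (D : set R) (g : R -> R) :
  measurable D -> measurable_fun setT g -> (forall x, 0 <= g x) ->
  (\int[lmu]_(x in (fun s => (c + s)%R) @^-1` D) (g (c + x)%R)%:E =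
   \int[lmu]_(x in D) (g x)%:E)%E.
Proof.
move=> mD mg g0.
have mphi : @measurable_fun _ _ (measurableTypeR R) (measurableTypeR R) setT
    (fun s => c + s) by exact: measurable_funD.
have mg' : measurable_fun D (fun x => (g x)%:E).
  by apply/measurable_EFinP; apply: measurable_funTS.
have g0' : {in D, forall y, (0 <= (g y)%:E)%E} by move=> x _; rewrite lee_fin g0.
rewrite -(ge0_integral_pushforward mphi lmu mD mg' g0').
apply: (@eq_measure_integral _ (measurableTypeR R)) => A mA _.
exact: lebesgue_measure_translation.
Qed.

End borel.

Lemma lebesgue_measure_disjoint_itvs {R : realType} n (l r : 'I_n -> R) :
  (forall i, l i <= r i) ->
  (forall i j, i != j -> `]l i, r i[ `&` `]l j, r j[ = set0) ->
  lebesgue_measure (\big[setU/set0]_(i < n) `]l i, r i[%classic : set R) =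
  (\sum_(i < n) (r i - l i))%:E.
Proof.
move=> lr disj; rewrite measure_bigsetU_ord//=; last first.
  by apply/trivIsetP => i j _ _; exact: disj.
rewrite -sumEFin; apply: eq_bigr => i _.
rewrite lebesgue_measure_itv/= lte_fin; case: ltP => // rl.
by rewrite (@le_anti _ _ (l i) (r i)) ?subrr// lr.
Qed.

(** * Primitives of nonnegative locally integrable functions *)

Section primitive.
Context {R : realType}.
Notation lmu := (@lebesgue_measure R).
Variable g : R -> R.
Hypothesis mg : measurable_fun setT g.
Hypothesis g0 : forall x, 0 <= g x.
Hypothesis gN : forall x, x < 0 -> g x = 0.
Hypothesis gint : forall b, 0 <= b ->
  (\int[lmu]_(x in `[0%R, b]) (g x)%:E < +oo)%E.

Let U b := \int[lmu]_(s in `[0, b]) g s.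

Let integrable_g b : lmu.-integrable `[0, b] (EFin \o g).
Proof.
have [b0|b0] := leP 0 b.
  apply/integrableP; split.
    by apply/measurable_EFinP; exact: measurable_funTS.
  by under eq_integral do rewrite /= ger0_norm//; exact: gint.
by rewrite set_itv_ge ?bnd_simp -?ltNge//; exact: integrable_set0.
Qed.

Let UE b : (\int[lmu]_(x in `[0%R, b]) (g x)%:E = (U b)%:E)%E.
Proof.
by rewrite /U /Rintegral fineK//; exact: integrable_fin_num (integrable_g b).
Qed.

Let UB a b : 0 <= a -> a <= b ->
  (\int[lmu]_(x in `[a, b]) (g x)%:E = (U b - U a)%:E)%E.
Proof.
move=> a0 ab.
have mgD D : measurable_fun D (fun x => (g x)%:E).
  by apply/measurable_EFinP; exact: measurable_funTS.
have := UE b; rewrite (@itv_bndbnd_setU _ _ _ (BRight a))//=.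
rewrite ge0_integral_setU//=; last first.
- apply/disj_setPLR => x /=; rewrite !in_itv/= => /andP[_ xa].
  by rewrite ltNge xa.
- by move=> x _; rewrite lee_fin.
  exact: mgD.
rewrite UE integral_itv_obnd_cbnd//.
by rewrite EFinB => <-; rewrite addeAC subee ?add0e.
Qed.

(** Since [g] vanishes on the negative axis, its integral over a compact set is at most that over
    some [[0, b]]. *)
Let locally_integrable_g : locally_integrable setT g.
Proof.
split=> [//||K _ cK]; first exact: openT.
have [M [Mr KM]] := compact_bounded cK.
pose b := Num.max 0 (M + 1).
have mK : measurable K by exact: compact_measurable.
apply: le_lt_trans (gint (_ : 0 <= b)); last by rewrite le_max lexx.
under eq_integral do rewrite ger0_norm//.
have KE : (\int[lmu]_(x in K) (g x)%:E =
    \int[lmu]_(x in K `&` `[0%R, +oo[) (g x)%:E)%E.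
  rewrite integral_mkcondr; apply: eq_integral => x _; rewrite patchE.
  case: ifPn => //; rewrite notin_setE/= in_itv/= andbT => /negP.
  by rewrite -ltNge => /gN ->.
rewrite KE; apply: ge0_subset_integral => //=.
- exact: measurableI.
- by apply/measurable_EFinP; exact: measurable_funTS.
- by move=> x _; rewrite lee_fin.
move=> x [Kx]; rewrite /= !in_itv/= andbT => -> /=.
have : `|x| <= M + 1 by apply: KM => //; rewrite ltrDl.
by move/(le_trans (ler_norm _)) => /le_trans; apply; rewrite le_max lexx orbT.
Qed.

Let derive_U : {ae lmu, forall x : R, 0 < x -> is_derive x 1 U (g x)}.
Proof.
have := FTC1 (a := BLeft 0) integrable_g locally_integrable_g.
apply: filterS; first exact: (ae_filter_ringOfSetsType lmu).
move=> x h x0; have [dU <-] : derivable U x 1 /\ derive1 U x = g x.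
  by apply: h; rewrite lte_fin.
by apply: DeriveDef; [exact: dU|rewrite -derive1E].
Qed.

(** Absolute continuity of the integral, applied to the union of the intervals: there the integral
    of [g] is the sum of the increments of [U]. *)
Let ac_U b : 0 <= b -> absolutely_continuous 0 b U.
Proof.
move=> b0 e e0.
have intT : lmu.-integrable setT (EFin \o (g \_ `[0, b])).
  by rewrite -restrict_EFin; apply/integrable_restrict => //=; rewrite setTI.
have [delta [delta0 small]] := integral_normr_continuous intT e0.
exists delta => // n l r lr disj sumlr.
have lri i : l i <= r i by have [] := lr i.
have mA : measurable (\big[setU/set0]_(i < n) `]l i, r i[%classic : set R).
  exact: bigsetU_measurable.
have /small : (lmu (\big[setU/set0]_(i < n) `]l i, r i[%classic) < delta%:E)%E.
  by rewrite lebesgue_measure_disjoint_itvs// lte_fin.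
move=> /(_ mA); apply: le_lt_trans.
rewrite -lee_fin /Rintegral fineK; last first.
  apply: integrable_fin_num => //.
  by apply: (integrableS measurableT) => //; exact: (integrable_norm intT).
have tI : trivIset [set` index_enum 'I_n] (fun i => `]l i, r i[%classic : set R).
  by apply/trivIsetP => i j _ _; exact: disj.
rewrite (ge0_integral_bigsetU lmu _ (index_enum_uniq _) tI)//=; last first.
  apply/measurable_EFinP; apply: measurableT_comp => //.
  apply: measurable_funTS; apply/measurable_EFinP.
  exact: measurable_int intT.
rewrite -sumEFin; apply: lee_sum => i _.
have [l0 _ rb] := lr i.
have r0 : 0 <= r i by rewrite (le_trans l0).
have := UB l0 (lri i).
have gD D : measurable_fun D (fun x => (g x)%:E).
  by apply/measurable_EFinP; exact: measurable_funTS.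
rewrite -integral_itv_obnd_cbnd// -integral_itv_bndo_bndc// => UBE.
rewrite ger0_norm; last first.
  by rewrite -lee_fin -UBE; apply: integral_ge0 => x _; rewrite lee_fin.
rewrite -UBE le_eqVlt; apply/orP; left; apply/eqP/eq_integral => x.
rewrite inE/= in_itv/= => /andP[lx xr]; rewrite patchE mem_set ?ger0_norm//=.
by rewrite in_itv/= (le_trans l0 (ltW lx))/= (le_trans (ltW xr)).
Qed.

Lemma ge0_primitive : exists V : R -> R, [/\
  forall b, 0 <= b -> absolutely_continuous 0 b V,
  {ae lmu, forall x : R, 0 < x -> is_derive x 1 V (g x)} &
  forall a b, 0 <= a -> a <= b ->
    (\int[lmu]_(x in `[a, b]) (g x)%:E = (V b - V a)%:E)%E].
Proof. by exists U; split. Qed.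

End primitive.

(** All later knowledge about integrals of the weights comes from here. The third property concerns
    translates, as weak-star convergence does; the fourth turns an arrow into positive weight on a
    bounded interval. [U] is the primitive of a Borel version of [u]. *)
Lemma completed_primitive {R : realType} (u : R -> R) :
  (forall t, 0 <= t -> 0 <= u t) -> integrable_on_compacts u ->
  exists U : R -> R, [/\
    forall b, 0 <= b -> absolutely_continuous 0 b U,
    {ae @lebesgue_measure R, forall t : R, 0 < t ->
      is_derive t 1 U (u t)},
    forall c T, 0 <= c -> 0 <= T ->
      (\int[@completed_lebesgue_measure R]_(s in `[0%R, T]) (u (c + s)%R)%:E =
       (U (c + T) - U c)%:E)%E &
    (0 < \int[@completed_lebesgue_measure R]_(s in `[0%R : R, +oo[) (u s)%:E)%E ->
      exists2 T, 0 <= T & U 0 < U T].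
Proof.
set lmu := @lebesgue_measure R; move=> u0 uint.
pose T := caratheodory_type (wlength (@idfun R))^*%mu.
have mitv (i : interval R) : @measurable _ T [set` i].
  by apply: sub_caratheodory; exact: measurable_itv.
(* The half-line is the union of the intervals [[0, i + 1]], on each of which [u] is integrable. *)
have mu0 : @measurable_fun _ _ T R setT (u \_ `[0%R, +oo[).
  have := (@measurable_restrictT _ _ T R _ u (mitv `[0%R, +oo[)).1; apply.
  rewrite itv0y_bigcup0S; apply/measurable_fun_bigcup => [i|i]; first exact: mitv.
  by apply/measurable_EFinP; apply: measurable_int (uint 0 i.+1%:R _ _).
have u00 x : 0 <= (u \_ `[0%R, +oo[) x.
  by rewrite patchE; case: ifPn => // /set_mem /=; rewrite in_itv/= andbT => /u0.
have [h [mh h0 [M nM hM]]] := completed_borel_version mu0 u00.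
(* The values of [h] on [M] are arbitrary, so it is cut off once more to vanish at negative
   points. *)
pose g := h \_ `[0%R, +oo[.
have mg : measurable_fun setT g.
  by apply/(measurable_restrictT h) => //; exact: measurable_funTS.
have g0 x : 0 <= g x by rewrite /g patchE; case: ifPn.
have gN x : x < 0 -> g x = 0.
  move=> xN; rewrite /g patchE ifN// notin_setE/= in_itv/= andbT.
  by apply/negP; rewrite -ltNge.
have gu x : 0 <= x -> ~ M x -> u x = g x.
  move=> x0 Mx; have xI : x \in (`[0%R, +oo[%classic : set R).
    by rewrite inE/= in_itv/= x0.
  by rewrite /g patchE xI hM// patchE xI.
have gint b : 0 <= b -> (\int[lmu]_(x in `[0%R, b]) (g x)%:E < +oo)%E.
  move=> b0; rewrite -(@completed_ae_integral _ _ u _ M)//.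
  - have /integrableP[_] := uint _ _ (lexx 0) b0.
    by under eq_integral => x /set_mem xI do rewrite /= ger0_norm ?u0 ?(itvP xI)//.
  - by move=> x; rewrite /= in_itv/= => /andP[/u0].
  - by move=> x; rewrite /= in_itv/= => /andP[x0 _]; exact: gu.
have [U [acU dU UB]] := ge0_primitive mg g0 gN gint.
exists U; split => //.
- have Mlt : lmu.-negligible
      (M `|` [set x : R | ~ (0 < x -> is_derive x 1 U (g x))]).
    exact: negligibleU.
  apply: (negligibleS _ Mlt) => x /= nd.
  have [Mx|Mx] := pselect (M x); [by left|right => gd; apply: nd => x0].
  by rewrite gu ?ltW//; exact: gd.
- move=> c b c0 b0; rewrite -UB// ?lerDl//.
  rewrite -(ge0_integral_translation c)//.
  have -> : (fun s => c + s) @^-1` `[c, c + b] = (`[0, b]%classic : set R).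
    by apply/seteqP; split => x /=; rewrite !in_itv/= lerDl lerD2l.
  have nMc : lmu.-negligible ((fun s => c + s) @^-1` M).
    case: nM => A [mA A0 MA]; exists ((fun s => c + s) @^-1` A); split.
    - rewrite -[_ @^-1` _]setTI; have : measurable_fun setT (fun s : R => c + s).
        exact: measurable_funD.
      by apply.
    - by rewrite -[RHS]A0; exact: lebesgue_measure_translation.
    - by move=> x /MA.
  apply: (completed_ae_integral _ _ _ _ nMc) => //.
  + by apply: (measurableT_comp mg); exact: measurable_funD.
  + by move=> x; rewrite /= in_itv/= => /andP[x0 _]; rewrite u0// addr_ge0.
  + by move=> x; rewrite /= in_itv/= => /andP[x0 _]; apply: gu; rewrite addr_ge0.
- rewrite (@completed_ae_integral _ _ u g M)//; last 2 first.
  + by move=> x; rewrite /= in_itv/= andbT => /u0.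
  + by move=> x; rewrite /= in_itv/= andbT; exact: gu.
  (* If [U] never exceeds [U 0], the integrals over all [[0, n + 1]] vanish, and by monotone
     convergence so does the integral over the half-line. *)
  move=> pos; apply: contrapT => nT; move: pos.
  suff -> : (\int[lmu]_(x in `[0%R, +oo[) (g x)%:E = 0)%E by rewrite ltxx.
  have U0 n : (\int[lmu]_(x in `[0%R, n.+1%:R]) (g x)%:E = 0)%E.
    apply/eqP; rewrite eq_le integral_ge0 ?andbT; last first.
      by move=> x _; rewrite lee_fin.
    rewrite UB// lee_fin subr_le0 leNgt; apply/negP => UT.
    by apply: nT; exists n.+1%:R.
  have : (\int[lmu]_(x in `[0%R, n.+1%:R]) (g x)%:E)%E @[n --> \oo] -->
      (\int[lmu]_(x in \bigcup_n `[0%R, n.+1%:R]%classic) (g x)%:E)%E.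
    apply: ge0_nondecreasing_set_cvg_integral => //.
    + move=> n m nm; apply/subsetPset/subset_itvl.
      by rewrite bnd_simp ler_nat ltnS.
    + by move=> n; apply/measurable_EFinP; exact: measurable_funTS.
    + by move=> n x _; rewrite lee_fin.
  rewrite -itv0y_bigcup0S (_ : (fun _ => _) = cst 0%E); last exact/funext.
  by move/(cvg_unique _ (cvg_cst _)) => <-.
Qed.

(** * Absolutely continuous functions *)

Section ac.
Context {R : realType}.

(** Common source of the closure properties below: each [F i] is used with tolerance [e / K], and
    the smallest of the resulting thresholds works for [h]. *)
Lemma ac_dominated (V W : normedModType R) (I : finType) (a b C : R)
    (F : I -> R -> V) (h : R -> W) :
  (forall i, absolutely_continuous a b (F i)) ->
  (forall s t, a <= s -> s <= t -> t <= b ->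
    `|h t - h s| <= C * \sum_i `|F i t - F i s|) ->
  absolutely_continuous a b h.
Proof.
move=> acF hF e e0.
(* [K] exceeds [|C|] times the number of indices and is positive even if [C] is 0 or [I] is
   empty. *)
pose K := (`|C| + 1) * #|I|.+1%:R.
have K0 : 0 < K by rewrite mulr_gt0// ?ltr0n// ltr_wpDl.
have eK : 0 < e / K by rewrite divr_gt0.
have /choice[del delP] : forall i, exists d : R, 0 < d /\ 
  forall (n : nat) (l r : 'I_n -> R),
      (forall i, [/\ a <= l i, l i <= r i & r i <= b]) ->
      (forall i j, i != j -> `]l i, r i[ `&` `]l j, r j[ = set0) ->
      \sum_(i < n) (r i - l i) < d ->
      \sum_(j < n) `|F i (r j) - F i (l j)| < e / K.
  by move=> i; have [d d0 H] := acF i _ eK; exists d.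
exists (\big[Num.min/1]_i del i).
  by apply/bigmin_gtP; split => // i _; have [] := delP i.
move=> n l r lr disj small.
apply: (@le_lt_trans _ _ (\sum_(j < n) (`|C| * \sum_i `|F i (r j) - F i (l j)|))).
  apply: ler_sum => j _; have [al lrj rb] := lr j.
  apply: le_trans (hF _ _ al lrj rb) _.
  by rewrite ler_wpM2r ?ler_norm// sumr_ge0.
rewrite -mulr_sumr exchange_big/=.
apply: (@le_lt_trans _ _ (`|C| * \sum_(i in I) (e / K))).
  rewrite ler_wpM2l//; apply: ler_sum => i _; apply: ltW.
  have [_] := delP i; apply => //; apply: lt_le_trans small _.
  exact: bigmin_le.
rewrite sumr_const -mulr_natr mulrCA -[X in _ < X](divfK (lt0r_neq0 K0)).
rewrite ltr_pM2l// /K -natr1 mulrDr mulr1 ltr_pwDr//.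
by rewrite ler_wpM2r// lerDl.
Qed.

Lemma ac_uniform (V : normedModType R) (a b : R) (f : R -> V) (e : R) :
  absolutely_continuous a b f -> 0 < e ->
  exists2 d, 0 < d & forall s t, a <= s -> s <= t -> t <= b -> t - s < d ->
    `|f t - f s| < e.
Proof.
move=> acf e0; have [d d0 H] := acf _ e0; exists d => // s t as_ st tb tsd.
have := H 1%N (fun=> s) (fun=> t).
rewrite !big_ord1; apply => // i j; by rewrite !ord1 eqxx.
Qed.

Lemma ac_subitv (V : normedModType R) (a b a' b' : R) (f : R -> V) :
  a <= a' -> b' <= b -> absolutely_continuous a b f ->
  absolutely_continuous a' b' f.
Proof.
move=> aa bb acf e e0; have [d d0 H] := acf _ e0; exists d => // n l r lr.
apply: H => i; have [al ? rb] := lr i; split => //.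
  exact: le_trans al.
exact: le_trans rb bb.
Qed.

(** Turns a derivative into the one-sided linear bound that expresses an upper right Dini
    derivative; this form passes to finite maxima. *)
Lemma is_derive_right_le (f : R -> R) (t D e : R) :
  is_derive t 1 f D -> 0 < e ->
  \forall s \near t^'+, f s <= f t + (D + e) * (s - t).
Proof.
move=> [df fD] e0.
have : (fun h : R => h^-1 *: (f (h *: 1 + t) - f t)) @ 0^' --> D by rewrite -fD.
move=> /cvgrPdist_lt /(_ _ e0) H.
move: H => [d /= d0 H].
near=> s.
have ts : 0 < s - t by rewrite subr_gt0; near: s; exact: nbhs_right_gt.
have := H (s - t); rewrite /= sub0r normrN gtr0_norm//.
have sd : s - t < d.
  by rewrite ltrBlDl; near: s; apply: nbhs_right_lt; rewrite ltrDl.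
move=> /(_ sd (lt0r_neq0 ts)).
rewrite [_ *: 1]mulr1 subrK distrC ltr_distl => /andP[_ /ltW].
rewrite (_ : _ *: _ = (f s - f t) / (s - t)); last exact: mulrC.
by rewrite ler_pdivrMr// lerBlDl.
Unshelve. all: by end_near. Qed.

End ac.

(** * Monotonicity from a Dini derivative bound almost everywhere *)

Definition partial_variations {R : realType} (f : R -> R) (O : set R)
    (a t : R) : set R :=
  [set v | exists n (l r : 'I_n -> R), [/\
    forall i, [/\ a <= l i, l i <= r i & r i <= t],
    forall i, `]l i, r i[ `<=` O,
    forall i j, i != j -> `]l i, r i[ `&` `]l j, r j[ = set0 &
    v = \sum_(i < n) `|f (r i) - f (l i)|]].

Lemma partial_variations0 {R : realType} (f : R -> R) (O : set R) (a t : R) :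
  partial_variations f O a t 0.
Proof.
exists 0%N, (fun=> 0), (fun=> 0); split; do ?by case.
by rewrite big_ord0.
Qed.

(** A family lying in [[a, s]] stays disjoint when []s, t[] is appended to it. This yields
    superadditivity of the variation. *)
Lemma partial_variations_rcons {R : realType} (f : R -> R) (O : set R)
    (a s t v : R) :
  a <= s -> s <= t -> `]s, t[ `<=` O -> partial_variations f O a s v ->
  partial_variations f O a t (v + `|f t - f s|).
Proof.
move=> as_ st stO [n [l [r [lr lrO disj ->]]]].
pose ext (x : R) (h : 'I_n -> R) (i : 'I_n.+1) := oapp h x (unlift ord_max i).
have extE x h i : ext x h (widen_ord (leqnSn n) i) = h i.
  rewrite /ext (_ : widen_ord _ i = lift ord_max i) ?liftK//.
  by apply/val_inj; rewrite /= /bump leqNgt ltn_ord.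
have extM x h : ext x h ord_max = x by rewrite /ext unlift_none.
have ordP (Q : 'I_n.+1 -> Prop) : (forall i, Q (widen_ord (leqnSn n) i)) ->
    Q ord_max -> forall i, Q i.
  move=> H1 H2 i; case: (unliftP ord_max i) => [j|] ->//.
  rewrite (_ : lift _ j = widen_ord (leqnSn n) j)//.
  by apply/val_inj; rewrite /= /bump leqNgt ltn_ord.
have disjM i : `]l i, r i[ `&` `]s, t[ = set0.
  apply/seteqP; split => // x /=; rewrite !in_itv/= => -[/andP[_ xr] /andP[sx _]].
  have [_ _ rs] := lr i.
  by have := lt_le_trans xr (le_trans rs (ltW sx)); rewrite ltxx.
exists n.+1, (ext s l), (ext t r); split.
- apply: (ordP) => [i|]; rewrite ?extE ?extM//; have [? ? rs] := lr i.
  by split => //; exact: le_trans st.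
- by apply: (ordP) => [i|]; rewrite ?extE ?extM.
- apply: (ordP) => [i|]; apply: (ordP) => [j|] //; rewrite ?extE ?extM => ij //.
  + by apply: disj; apply: contraNneq ij => ->.
  + by rewrite setIC.
  + by rewrite eqxx in ij.
by rewrite big_ord_recr/= !extM; under [in RHS]eq_bigr do rewrite !extE.
Qed.

Lemma partial_variationsS {R : realType} (f : R -> R) (O : set R) (a s t : R) :
  s <= t -> partial_variations f O a s `<=` partial_variations f O a t.
Proof.
move=> st v [n [l [r [lr lrO disj vE]]]]; exists n, l, r; split => // i.
by have [? ? rs] := lr i; split => //; exact: le_trans st.
Qed.

(* Real induction on the set of [t] with [f t <= f a + e * (t - a) + V t], where
   [V t] is the variation of [f] on the part of an open neighbourhood [O] of the
   exceptional null set that lies in [[a, t]]; absolute continuity makes [V]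
   small when [O] has small measure. *)
Lemma ac_ae_dini_nonincreasing {R : realType} (f : R -> R) (a b : R) : a <= b ->
  absolutely_continuous a b f ->
  {ae @lebesgue_measure R, forall t : R, a < t -> t < b ->
    forall e, 0 < e -> \forall s \near t^'+, f s <= f t + e * (s - t)} ->
  f b <= f a.
Proof.
move=> ab acf good.
(* One [e] is the slope allowed off the open set, the other bounds the variation on it; rescaling by
   [b - a + 1] makes their total arbitrarily small. *)
suff H e : 0 < e -> f b <= f a + e * (b - a) + e.
  apply/ler_addgt0Pr => e e0.
  have ba : 0 < b - a + 1 by rewrite ltr_wpDl// subr_ge0.
  have := H (e / (b - a + 1)) (divr_gt0 e0 ba).
  by rewrite -addrA -[X in _ + (_ + X)]mulr1 -mulrDr divfK ?gt_eqF.
move=> e0; have [delta delta0 small] := acf _ e0.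
(* The Dini bound is only given at interior points, so [a] joins the exceptional set. *)
pose E := [set t : R | ~ (a < t -> t < b -> forall e : R, 0 < e ->
  \forall s \near t^'+, f s <= f t + e * (s - t))] `|` [set a].
have nE : (@lebesgue_measure R).-negligible E.
  apply: negligibleU; first exact: good.
  by exists [set a]; split => //; exact: lebesgue_measure_set1.
have d20 : 0 < delta / 2 by rewrite divr_gt0.
have [W [oO EO muO]] := outer_measure_open_le E d20.
have {}muO : (lebesgue_measure W < delta%:E)%E.
  apply: le_lt_trans muO _.
  rewrite ((negligible_outer_measure E).1 nE) add0e lte_fin ltr_pdivrMr//.
  by rewrite ltr_pMr// ltr1n.
pose PV := partial_variations f W a.
(* The intervals lie in [W], whose measure is below [delta]. *)
have PVe t v : t <= b -> PV t v -> v <= e.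
  move=> tb [n [l [r [lr lrO disj ->]]]]; apply/ltW/small => // [i|].
    by have [? ? rt] := lr i; split => //; exact: le_trans tb.
  rewrite -lte_fin -lebesgue_measure_disjoint_itvs//; last first.
    by move=> i; have [] := lr i.
  apply: le_lt_trans muO; apply: le_measure; rewrite ?inE.
  - by apply: bigsetU_measurable => i _; exact: measurable_itv.
  - exact: open_measurable.
  - apply: (big_ind (fun A : set R => A `<=` W)) => //.
    by move=> A B AW BW x [/AW|/BW].
pose V t := sup (PV t).
have supPV t : t <= b -> has_sup (PV t).
  move=> tb; split; first by exists 0; exact: partial_variations0.
  by exists e => v; exact: PVe.
have Vmono s t : s <= t -> t <= b -> V s <= V t.
  move=> st tb; apply: ge_sup; first by exists 0; exact: partial_variations0.
  move=> v /(partial_variationsS st) vt; apply: ub_le_sup => //.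
  by have [] := supPV _ tb.
have Vstep s t : a <= s -> s <= t -> t <= b -> `]s, t[ `<=` W ->
    V s + `|f t - f s| <= V t.
  move=> as_ st tb stO; rewrite -lerBrDr; apply: ge_sup.
    by exists 0; exact: partial_variations0.
  move=> v vs; rewrite lerBrDr; apply: ub_le_sup; first by have [] := supPV _ tb.
  exact: partial_variations_rcons vs.
pose S := [set t | [/\ a <= t, t <= b & f t <= f a + e * (t - a) + V t]].
have V0 t : t <= b -> 0 <= V t.
  move=> tb; apply: ub_le_sup; first by have [] := supPV _ tb.
  exact: partial_variations0.
have Sa : S a by split => //; rewrite subrr mulr0 addr0 lerDl V0.
have supS : has_sup S by split; [exists a|exists b => t []].
pose T := sup S.
have aT : a <= T by apply: ub_le_sup => //; case: supS.
have Tb : T <= b by apply: ge_sup; [exists a|move=> t []].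
(* The supremum belongs to [S] because [f] is continuous and the right side of the inequality
   defining [S] is nondecreasing. *)
have ST : S T.
  split => //; apply/ler_addgt0Pr => eta eta0.
  have [d d0 fd] := ac_uniform acf eta0.
  have [s [as_ sb fs] Ts] := sup_adherent d0 supS.
  have sT : s <= T by apply: ub_le_sup => //; case: supS.
  have := fd _ _ as_ sT Tb; rewrite ltrBlDr -ltrBlDl => /(_ Ts).
  rewrite ltr_distl => /andP[_ /ltW fT].
  apply: le_trans fT _; rewrite lerD2r; apply: le_trans fs _.
  by rewrite lerD ?Vmono// lerD2l ler_pM2l// lerD2r.
have Tmax t : T < t -> ~ S t.
  move=> Tt St; have : t <= T by apply: ub_le_sup => //; case: supS.
  by rewrite leNgt Tt.
have [_ _ fT] := ST.
have TbE : T = b.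
  apply/eqP; rewrite eq_le Tb leNgt; apply/negP => Tb'.
  (* Just after [T], the increment of [f] is paid for by [V] if [T] lies in [W], and by the Dini
     bound otherwise; either way [S] would extend beyond [T]. *)
  have [OT|OT] := pselect (W T).
    have [d /= d0 dO] : exists2 d : R, 0 < d & ball T d `<=` W.
      by apply/nbhs_ballP; exact: open_nbhs_nbhs.
    pose t := Num.min b (T + d).
    have Tt : T < t by rewrite lt_min Tb' ltrDl.
    have tb : t <= b by rewrite ge_min lexx.
    apply: (Tmax t Tt); split => //; first exact: le_trans (ltW Tt).
    have TtO : `]T, t[ `<=` W.
      move=> x; rewrite /= in_itv/= => /andP[Tx xt]; apply: dO.
      rewrite /ball/= ltr0_norm ?subr_lt0// opprB ltrBlDl.
      by apply: lt_le_trans xt _; rewrite ge_min lexx orbT.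
    have := Vstep _ _ aT (ltW Tt) tb TtO; rewrite -lerBrDl => fV.
    have {}fV := le_trans (ler_norm _) fV.
    have : e * (T - a) <= e * (t - a) by rewrite ler_pM2l// lerD2r ltW.
    by move: fV fT; lra.
  have nET : ~ E T by move=> /EO.
  have aT' : a < T.
    by rewrite lt_neqAle aT andbT; apply/eqP => aTE; apply: nET; right.
  have TT : \forall s \near T^'+, f s <= f T + e * (s - T).
    by apply: contrapT => h; apply: nET; left => /(_ aT' Tb' _ e0).
  have [t [Tt tb ft]] : exists t, [/\ T < t, t < b & f t <= f T + e * (t - T)].
    near T^'+ => s; exists s; split; near: s => //.
    - exact: nbhs_right_gt.
    - exact: nbhs_right_lt.
  apply: (Tmax t Tt); split => //; [exact: le_trans (ltW Tt)|exact: ltW|].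
  have := Vmono _ _ (ltW Tt) (ltW tb).
  by move: fT ft; lra.
move: fT; rewrite TbE => /le_trans; apply; rewrite lerD2l.
apply: ge_sup; first by exists 0; exact: partial_variations0.
by move=> v; exact: PVe.
Unshelve. all: by end_near. Qed.

(** * Closure properties of absolute continuity *)

Section ac_operations.
Context {R : realType} (a b : R).

Lemma ac_bounded (f : R -> R) : a <= b -> absolutely_continuous a b f ->
  exists2 B, 0 <= B & forall t, a <= t -> t <= b -> `|f t| <= B.
Proof.
move=> ab acf; have cf : {within `[a, b], continuous (fun t => `|f t|)}.
  apply/subspace_continuousP => x /=; rewrite in_itv/= => /andP[ax xb].
  apply/cvgrPdist_lt => e e0; have [d d0 fd] := ac_uniform acf e0.
  rewrite near_withinE; near=> t => /=; rewrite in_itv/= => /andP[at_ tb].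
  apply: (le_lt_trans (ler_dist_dist _ _)).
  have tx : `|x - t| < d by near: t; exact: nbhsx_ballx.
  have [tlex|/ltW xlet] := leP t x.
    by apply: fd => //; exact: le_lt_trans (ler_norm _) tx.
  rewrite distrC in tx; rewrite distrC; apply: fd => //.
  exact: le_lt_trans (ler_norm _) tx.
have [c cab fc] := EVT_max ab cf; exists `|f c| => // t at_ tb.
by apply: fc; rewrite in_itv/= at_.
Unshelve. all: by end_near. Qed.

Lemma ac_sum (I : finType) (F : I -> R -> R) :
  (forall i, absolutely_continuous a b (F i)) ->
  absolutely_continuous a b (fun t => \sum_i F i t).
Proof.
move=> acF; apply: (ac_dominated (C := 1) acF) => s t _ _ _.
by rewrite mul1r -sumrB ler_norm_sum.
Qed.

Lemma ac_affine (f : R -> R) (c d : R) : absolutely_continuous a b f ->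
  absolutely_continuous a b (fun t => c * f t + d).
Proof.
move=> acf; apply: (ac_dominated (I := unit) (C := `|c|) (F := fun=> f)) => //.
move=> s t _ _ _; rewrite big_const card_unit/= addr0 -normrM.
by rewrite opprD addrACA subrr addr0 mulrBr.
Qed.

Lemma ac_add (f g : R -> R) : absolutely_continuous a b f ->
  absolutely_continuous a b g -> absolutely_continuous a b (fun t => f t + g t).
Proof.
move=> acf acg.
apply: (ac_dominated (I := bool) (C := 1) (F := fun i => if i then f else g)).
  by case.
by move=> s t _ _ _; rewrite big_bool/= mul1r opprD addrACA ler_normD.
Qed.

Lemma ac_mul (f g : R -> R) : a <= b -> absolutely_continuous a b f ->
  absolutely_continuous a b g -> absolutely_continuous a b (fun t => f t * g t).
Proof.
move=> ab acf acg.
have [B B0 fB] := ac_bounded ab acf; have [C C0 gC] := ac_bounded ab acg.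
apply: (ac_dominated (I := bool) (C := B + C) (F := fun i => if i then f else g)).
  by case.
move=> s t as_ st tb; rewrite big_bool/=.
have -> : f t * g t - f s * g s = f t * (g t - g s) + g s * (f t - f s) by ring.
apply: le_trans (ler_normD _ _) _; rewrite !normrM.
have := fB t (le_trans as_ st) tb; have := gC s as_ (le_trans st tb).
have := normr_ge0 (g t - g s); have := normr_ge0 (f t - f s).
have := normr_ge0 (f t); have := normr_ge0 (g s).
set p := `|f t|; set q := `|g s|; set v := `|f t - f s|; set w := `|g t - g s|.
by move=> *; nra.
Qed.

Lemma ac_expR (f : R -> R) : a <= b -> absolutely_continuous a b f ->
  absolutely_continuous a b (fun t => expR (f t)).
Proof.
move=> ab acf; have [B B0 fB] := ac_bounded ab acf.
(* On []-oo, B]] the exponential is Lipschitz with constant [expR B]. *)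
have lip x y : x <= y -> y <= B -> `|expR y - expR x| <= expR B * `|y - x|.
  move=> xy yB; rewrite !ger0_norm ?subr_ge0 ?ler_expR//.
  have -> : expR y - expR x = expR y * (1 - expR (x - y)).
    by rewrite mulrBr mulr1 -expRD subrKC.
  apply: ler_pM => //; first by rewrite subr_ge0 -expR0 ler_expR subr_le0.
    by rewrite ler_expR.
  by have := expR_ge1Dx (x - y); lra.
apply: (ac_dominated (I := unit) (C := expR B) (F := fun=> f)) => //.
move=> s t as_ st tb; rewrite big_const card_unit/= addr0.
have ft := le_trans (ler_norm _) (fB t (le_trans as_ st) tb).
have fs := le_trans (ler_norm _) (fB s as_ (le_trans st tb)).
have [fst_|/ltW fts] := leP (f s) (f t); first exact: lip.
by rewrite distrC [X in _ * X]distrC; exact: lip.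
Qed.

End ac_operations.

#[local] Instance lebesgue_ae_filter {R : realType} :
  Filter (almost_everywhere (@lebesgue_measure R)).
Proof. exact: ae_filter_ringOfSetsType. Qed.

Lemma ac_ae_derive_nonincreasing {R : realType} (f : R -> R) (a b : R) : a <= b ->
  absolutely_continuous a b f ->
  {ae @lebesgue_measure R, forall t : R, a < t -> t < b ->
    exists2 D, is_derive t 1 f D & D <= 0} ->
  f b <= f a.
Proof.
move=> ab acf fD; apply: ac_ae_dini_nonincreasing acf _ => //.
apply: filterS fD => t fD at_ tb e e0; have [D dD D0] := fD at_ tb.
have := is_derive_right_le dD e0; apply: filterS2 (nbhs_right_gt t) => s ts.
move=> /le_trans; apply; rewrite lerD2l ler_wpM2r ?subr_ge0 ?(ltW ts)//; lra.
Qed.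

(** This makes the maximum of finitely many absolutely continuous functions absolutely
    continuous. *)
Lemma bigmax_dist {R : realDomainType} {I : finType} (C : R) (f g : I -> R) :
  `|\big[Num.max/C]_k f k - \big[Num.max/C]_k g k| <= \sum_k `|f k - g k|.
Proof.
have H (f' g' : I -> R) : \big[Num.max/C]_k f' k <=
    \big[Num.max/C]_k g' k + \sum_k `|f' k - g' k|.
  apply: bigmax_le => [|k _].
    by rewrite ler_wpDr ?sumr_ge0//; exact: bigmax_ge_id.
  have gk : g' k <= \big[Num.max/C]_k g' k by exact: le_bigmax.
  have fgk : `|f' k - g' k| <= \sum_k `|f' k - g' k|.
    by rewrite (bigD1 k)//= lerDl sumr_ge0.
  by have := ler_norm (f' k - g' k); lra.
rewrite ler_distl; have := H f g; have := H g f.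
have -> : \sum_k `|g k - f k| = \sum_k `|f k - g k|.
  by apply: eq_bigr => k _; exact: distrC.
lra.
Qed.

(** * Scalar solutions: maximum principle, window estimates and consensus *)

Section scalar.
Context {R : realType} {N : nat}.
Variables u U : 'I_N -> 'I_N -> R -> R.
Hypothesis u_ge0 : forall j k t, 0 <= t -> 0 <= u j k t.
Hypothesis acU : forall j k b, 0 <= b -> absolutely_continuous 0 b (U j k).
Hypothesis dU : forall j k, {ae @lebesgue_measure R, forall t : R, 0 < t ->
  is_derive t 1 (U j k) (u j k t)}.
Hypothesis U_mono : forall j k a b, 0 <= a -> a <= b -> U j k a <= U j k b.

Definition scalar_solution (y : 'I_N -> R -> R) :=
  (forall j b, 0 <= b -> absolutely_continuous 0 b (y j)) /\
  (forall j, {ae @lebesgue_measure R, forall t : R, 0 < t ->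
     is_derive t 1 (y j) (\sum_k u j k t * (y k t - y j t))}).

(** By linearity, a change of sign turns every upper bound into a lower bound. *)
Lemma scalar_solution_opp y : scalar_solution y ->
  scalar_solution (fun j t => - y j t).
Proof.
move=> [acy dy]; split => [j b b0|j].
  rewrite (_ : (fun t => _) = (fun t => (-1) * y j t + 0)).
    exact/ac_affine/acy.
  by apply/funext => t; rewrite mulN1r addr0.
apply: filterS (dy j) => t d t0.
rewrite (_ : \sum_k _ = - \sum_k u j k t * (y k t - y j t)).
  by apply: is_deriveN; exact: d.
by rewrite -sumrN; apply: eq_bigr => k _; ring.
Qed.

(** Maximum principle. A component equal to [w] has only nonpositive terms in its derivative; one
    strictly below [w] stays below for a while by continuity. As [C] is the default value of the
    maximum, [w a] is [C]. *)
Lemma solution_le y (C a b : R) : scalar_solution y -> 0 <= a -> a <= b ->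
  (forall k, y k a <= C) -> forall k, y k b <= C.
Proof.
move=> [acy dy] a0 ab yaC k; have b0 := le_trans a0 ab.
pose w t := \big[Num.max/C]_k y k t.
have acw : absolutely_continuous a b w.
  apply: (ac_dominated (C := 1) (F := y)) => [i|s t _ _ _].
    by apply: ac_subitv (acy i b b0).
  by rewrite mul1r; exact: bigmax_dist.
apply: (@le_trans _ _ (w b)); first exact: le_bigmax.
apply: (@le_trans _ _ (w a)); last exact: bigmax_le.
apply: ac_ae_dini_nonincreasing => //.
have := filter_forall lebesgue_ae_filter dy; apply: filterS => t d at_ tb e e0.
have t0 : 0 < t by exact: le_lt_trans at_.
have yw i : y i t <= w t by exact: le_bigmax.
have Cw : C <= w t by exact: bigmax_ge_id.
suff H : \forall s \near t^'+, forall i, y i s <= w t + e * (s - t).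
  apply: filterS2 (nbhs_right_gt t) H => s ts H; apply: bigmax_le => //.
  by rewrite ler_wpDr// mulr_ge0 ?subr_ge0 ?ltW.
apply: filter_forall => i; have di := d i t0.
have [ywi|ywi] := eqVneq (y i t) (w t).
  have := is_derive_right_le di e0; apply: filterS2 (nbhs_right_gt t) => s ts.
  move=> /le_trans; apply; rewrite ywi lerD2l ler_wpM2r ?subr_ge0 ?(ltW ts)//.
  rewrite gerDr; apply: sumr_le0 => l _.
  by rewrite mulr_ge0_le0 ?u_ge0 ?(ltW t0)// subr_le0.
have {}ywi : y i t < w t by rewrite lt_neqAle ywi yw.
have cy : {for t, continuous (y i)}.
  by apply: differentiable_continuous; apply/derivable1_diffP; case: di.
near=> s; have ts : t < s by near: s; exact: nbhs_right_gt.
apply: (@le_trans _ _ (w t)); last by rewrite ler_wpDr// mulr_ge0 ?subr_ge0 ?ltW.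
apply: ltW; near: s; apply: cvg_within.
exact: (@cvgr_lt _ _ _ _ _ _ cy).
Unshelve. all: by end_near. Qed.

Lemma solution_ge y (C a b : R) : scalar_solution y -> 0 <= a -> a <= b ->
  (forall k, C <= y k a) -> forall k, C <= y k b.
Proof.
move=> sol a0 ab yaC k; rewrite -lerN2.
by apply: (solution_le (scalar_solution_opp sol) a0 ab) => i; rewrite lerN2.
Qed.

(* [(y j - C) * exp (\sum_k (U j k - U j k s))] is nonincreasing. *)
Lemma solution_gronwall y (C s b : R) j : scalar_solution y -> 0 <= s -> s <= b ->
  (forall k, y k s <= C) ->
  C - y j s <= (C - y j b) * expR (\sum_k (U j k b - U j k s)).
Proof.
move=> sol s0 sb ysC; have [acy dy] := sol; have b0 := le_trans s0 sb.
pose A t := \sum_k (U j k t - U j k s).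
pose h t := (y j t - C) * expR (A t).
suff : h b <= h s.
  rewrite /h /A [X in _ <= _ * expR X]big1 => [|k _]; last exact: subrr.
  by rewrite expR0 mulr1; lra.
apply: ac_ae_derive_nonincreasing => //.
  have acyb := ac_subitv s0 (lexx b) (acy j b b0).
  apply: ac_mul => //.
    by have := ac_affine 1 (- C) acyb; under eq_fun do rewrite mul1r.
  apply: ac_expR => //; apply: ac_sum => k.
  have := ac_affine 1 (- U j k s) (ac_subitv s0 (lexx b) (acU j k b0)).
  by under eq_fun do rewrite mul1r.
have := filter_forall lebesgue_ae_filter (dU j).
apply: filterS2 (dy j) => t dyt dUt st tb.
have t0 : 0 < t by exact: le_lt_trans st.
have dyt' := dyt t0; have dUt' k := dUt k t0.
(* The integrating factor replaces [y k t - y j t] by [y k t - C], which is nonpositive by the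
   maximum principle. *)
exists (expR (A t) * \sum_k u j k t * (y k t - C)).
  have dA : is_derive t 1 A (\sum_k u j k t).
    have dk k : is_derive t 1 (fun t => U j k t - U j k s) (u j k t).
      rewrite -[u j k t]subr0.
      have := is_deriveB (dUt' k) (is_derive_cst (U j k s) t 1).
      exact.
    rewrite /A (_ : (fun t => _) = \sum_k (fun t => U j k t - U j k s)); last first.
      by apply/funext => x; rewrite fct_sumE.
    exact: is_derive_sum.
  have dE : is_derive t 1 (expR \o A) (expR (A t) * \sum_k u j k t).
    exact: is_derive1_comp.
  have dyC : is_derive t 1 (y j - cst C) (\sum_k u j k t * (y k t - y j t) - 0).
    have := is_deriveB dyt' (is_derive_cst C t 1).
    exact.
  have := is_deriveM dyC dE; rewrite subr0.
  rewrite (_ : _ *: _ + _ *: _ = expR (A t) * \sum_k u j k t * (y k t - C))//.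
  have -> : \sum_k u j k t * (y k t - C) =
      \sum_k u j k t * (y k t - y j t) + (y j t - C) * \sum_k u j k t.
    by rewrite mulr_sumr -big_split/=; apply: eq_bigr => k _; ring.
  rewrite mulrDr addrC /GRing.scale/=; congr (_ + _).
  by rewrite !fctE/=; ring.
rewrite mulr_ge0_le0 ?expR_ge0//; apply: sumr_le0 => k _.
rewrite mulr_ge0_le0 ?u_ge0 ?(ltW t0)// subr_le0.
exact: (solution_le sol s0 (ltW st)).
Qed.

(** Integrated equation: per unit of weight, each node pulls [y j] up by at most [e], while node [k]
    changes it by at most [- D]. *)
Lemma solution_drop y (e D s b : R) j k : scalar_solution y -> 0 <= s -> s <= b ->
  0 <= e ->
  (forall l t, s < t -> t < b -> y l t - y j t <= e) ->
  (forall t, s < t -> t < b -> y k t - y j t <= - D) ->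
  y j b - y j s <= e * \sum_l (U j l b - U j l s) - D * (U j k b - U j k s).
Proof.
move=> [acy dy] s0 sb e0 ye yD; have b0 := le_trans s0 sb.
(* Up to a constant, [h] is [y j] minus the claimed bound; the [+ 0] match the form of
   [ac_affine]. *)
pose h t := y j t + (- e * (\sum_l U j l t) + 0) + (D * U j k t + 0).
have : h b <= h s; last by rewrite /h sumrB; lra.
apply: ac_ae_derive_nonincreasing => //.
  apply: (ac_subitv s0 (lexx b)); apply: ac_add; last exact/ac_affine/acU.
  apply: ac_add; first exact: acy.
  by apply/ac_affine/ac_sum => l; exact: acU.
have := filter_forall lebesgue_ae_filter (dU j).
apply: filterS2 (dy j) => t dyt dUt st tb.
have t0 : 0 < t by exact: le_lt_trans st.
have dyt' := dyt t0; have dUt' l := dUt l t0.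
exists (\sum_l u j l t * (y l t - y j t) - e * (\sum_l u j l t) + D * u j k t).
  have dS : is_derive t 1 (\sum_l U j l) (\sum_l u j l t).
    exact: is_derive_sum.
  have := is_deriveD (is_deriveD dyt' (is_deriveZ (- e) dS))
    (is_deriveZ D (dUt' k)).
  rewrite /GRing.scale/= mulNr; congr is_derive; apply/funext => x.
  by rewrite /h !fctE !addr0 fct_sumE.
rewrite mulr_sumr -sumrB (bigD1 k)//=.
have -> : u j k t * (y k t - y j t) - e * u j k t + \sum_(l | l != k)
   (u j l t * (y l t - y j t) - e * u j l t) + D * u j k t =
   u j k t * (y k t - y j t + D) + - (e * u j k t) + \sum_(l | l != k)
   (u j l t * (y l t - y j t - e)).
  rewrite (eq_bigr (fun l => u j l t * (y l t - y j t - e))) => [|l _]; ring.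
have t0' := ltW t0.
have q1 : u j k t * (y k t - y j t + D) <= 0.
  by rewrite mulr_ge0_le0 ?u_ge0//; have := yD t st tb; lra.
have q2 : - (e * u j k t) <= 0 by rewrite oppr_le0 mulr_ge0 ?u_ge0.
have q3 : \sum_(l | l != k) u j l t * (y l t - y j t - e) <= 0.
  apply: sumr_le0 => l _; rewrite mulr_ge0_le0 ?u_ge0// subr_le0.
  exact: ye.
by have := lerD (lerD q1 q2) q3; rewrite !addr0.
Qed.

(** By Gronwall, [y j] stays near [M + e] and [y k] near [m - e] on the whole window, so the weight
    [c] pulls [y j] down by about [c * (M - m)]. But [y j] starts at most at [M + e] and ends at
    least at [M], so it drops by at most [e]. *)
Lemma window_gap y (K c e M m s b : R) j k :
  scalar_solution y -> 0 <= s -> s <= b ->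
  (forall i, \sum_l (U i l b - U i l s) <= K) -> 0 < e -> 0 < c ->
  (forall l, y l s <= M + e) -> (forall l, m - e <= y l s) ->
  M <= y j b -> y k b <= m ->
  c <= U j k b - U j k s -> 2 * e * expR K <= M - m ->
  c * (M - m) <= e * (expR K * K + 1 + 2 * c * expR K).
Proof.
move=> sol s0 sb UK e0 c0 yM ym Mj km cU small.
have E1 : 1 <= expR K.
  rewrite -expR0 ler_expR (le_trans _ (UK j))//; apply: sumr_ge0 => l _.
  by rewrite subr_ge0 U_mono.
have K0 : 0 <= K by rewrite -ler_expR expR0.
have UKt i t : s <= t -> t <= b -> expR (\sum_l (U i l b - U i l t)) <= expR K.
  move=> st tb; rewrite ler_expR; apply: le_trans (UK i); apply: ler_sum => l _.
  by rewrite lerD2l lerN2 U_mono.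
have yMt l t : s <= t -> y l t <= M + e.
  by move=> st; exact: (solution_le sol s0 st yM).
have ymt l t : s <= t -> m - e <= y l t.
  by move=> st; exact: (solution_ge sol s0 st ym).
have near_top t : s <= t -> t <= b -> M + e - y j t <= e * expR K.
  move=> st tb; have t0 := le_trans s0 st.
  have := solution_gronwall j sol t0 tb (fun l => yMt l t st).
  move=> /le_trans; apply; apply: ler_pM; rewrite ?expR_ge0 ?UKt//.
    by rewrite subr_ge0 yMt.
  by lra.
have near_bot t : s <= t -> t <= b -> y k t - (m - e) <= e * expR K.
  move=> st tb; have t0 := le_trans s0 st.
  have yN l : - y l t <= - (m - e) by rewrite lerN2 ymt.
  have := solution_gronwall k (scalar_solution_opp sol) t0 tb yN.
  rewrite !opprK [- _ + _]addrC [- (m - e) + _]addrC.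
  move=> /le_trans; apply; apply: ler_pM; rewrite ?expR_ge0 ?UKt//.
    by rewrite subr_ge0 ymt.
  by lra.
(* The factor of the weight is the distance from [M + e] to [m - e], less [e * expR K] at either
   end. *)
have drop : y j b - y j s <= e * expR K * \sum_l (U j l b - U j l s) -
    (M - m + 2 * e - 2 * e * expR K) * (U j k b - U j k s).
  apply: solution_drop => //; first by rewrite mulr_ge0 ?ltW// expR_gt0.
    move=> l t /ltW st /ltW tb.
    by have := yMt l t st; have := near_top t st tb; lra.
  move=> t /ltW st /ltW tb.
  by have := near_top t st tb; have := near_bot t st tb; lra.
have eE0 : 0 <= e * expR K by rewrite mulr_ge0 ?ltW// expR_gt0.
have p1 : e * expR K * \sum_l (U j l b - U j l s) <= e * expR K * K.
  by rewrite ler_wpM2l.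
(* [small] makes this factor nonnegative, so the weight can be replaced by its lower bound [c]. *)
have p2 : (M - m + 2 * e - 2 * e * expR K) * c <=
   (M - m + 2 * e - 2 * e * expR K) * (U j k b - U j k s).
  by rewrite ler_wpM2l//; lra.
have := yM j; have ec : 0 <= e * c by rewrite mulr_ge0 ?ltW.
by move: drop p1 p2 Mj; set X := _ * \sum_l _; set Y := _ * (U j k b - _); nra.
Qed.

Hypothesis N_gt0 : (0 < N)%N.
Variables K c : R.
Hypothesis c_gt0 : 0 < c.
(** The only trace of weak-star convergence and of the graph in the scalar argument. *)
Hypothesis windows : forall t0, exists s b, [/\ 0 <= s, t0 <= s, s <= b,
  forall j, \sum_k (U j k b - U j k s) <= K &
  forall j k, j != k -> c <= U j k b - U j k s \/ c <= U k j b - U k j s].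

Lemma scalar_consensus y : scalar_solution y ->
  exists ystar : R, forall j : 'I_N, y j t @[t --> +oo] --> ystar.
Proof.
move=> sol; have k0 : 'I_N := Ordinal N_gt0.
(* By the maximum principle a bound valid at one time persists, so the infimum of [top] and the
   supremum of [bot] are the limits of the largest and the smallest component. *)
pose top := [set C | exists2 t, 0 <= t & forall k, y k t <= C].
pose bot := [set C | exists2 t, 0 <= t & forall k, C <= y k t].
have bot_top m M : bot m -> top M -> m <= M.
  move=> [s s0 ys] [t t0 yt].
  have := solution_le sol t0 (_ : t <= Num.max s t) yt k0.
  rewrite le_max lexx orbT => /(_ isT); apply: le_trans.
  by apply: (solution_ge sol s0) => //; rewrite le_max lexx.
have topj t : 0 <= t -> exists2 j, top (y j t) & forall k, y k t <= y j t.
  move=> t0; case: (@arg_maxP _ _ _ k0 xpredT (fun i => y i t)) => // j _ yj.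
  by exists j => [|k]; [exists t => // k; exact: yj|exact: yj].
have botj t : 0 <= t -> exists2 j, bot (y j t) & forall k, y j t <= y k t.
  move=> t0; case: (@arg_minP _ _ _ k0 xpredT (fun i => y i t)) => // j _ yj.
  by exists j => [|k]; [exists t => // k; exact: yj|exact: yj].
have [[j0 top0 _] [l0 bot0 _]] := (topj 0 (lexx 0), botj 0 (lexx 0)).
have inft : has_inf top.
  by split; [exists (y j0 0)|exists (y l0 0) => C; exact: bot_top].
have supb : has_sup bot.
  by split; [exists (y l0 0)|exists (y j0 0) => C /bot_top; exact].
pose M := inf top; pose m := sup bot.
have Mtop C : top C -> M <= C by apply: ge_inf; case: inft.
have mbot C : bot C -> C <= m by apply: ub_le_sup; case: supb.
have mM : m <= M.
  apply: ge_sup; first by exists (y l0 0).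
  by move=> C Cb; apply: lb_le_inf; [exists (y j0 0)|move=> C'; exact: bot_top].
have eventually e : 0 < e -> exists2 t0, 0 <= t0 &
    forall t k, t0 <= t -> m - e <= y k t /\ y k t <= M + e.
  move=> e0; have [C [t1 t10 yC] CM] := inf_adherent e0 inft.
  have [C' [t2 t20 yC'] mC'] := sup_adherent e0 supb.
  exists (Num.max t1 t2) => [|t k]; first by rewrite le_max t10.
  rewrite ge_max => /andP[t1t t2t]; split.
    apply: le_trans (ltW mC') _; exact: (solution_ge sol t20).
  apply: le_trans _ (ltW CM); exact: (solution_le sol t10).
have MmE : M = m.
  apply/eqP; rewrite eq_le mM andbT leNgt; apply/negP => ltmM.
  pose E := expR K; pose L := E * K + 1 + 2 * c * E.
  have E0 : 0 < E by exact: expR_gt0.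
  have [s1 [b1 [s10 _ sb1 UK1 _]]] := windows 0.
  have K0 : 0 <= K.
    apply: le_trans (UK1 k0); apply: sumr_ge0 => l _.
    by rewrite subr_ge0 U_mono.
  have EK0 : 0 <= E * K by rewrite mulr_ge0// ltW.
  have cE0 : 0 < c * E by rewrite mulr_gt0.
  have L0 : 0 < L by rewrite /L; lra.
  have cD0 : 0 < c * (M - m) by rewrite mulr_gt0// subr_gt0.
  (* With this choice the bound [e * L] of [window_gap] is half of [c * (M - m)]; the term
     [2 * c * E] of [L] also gives [small]. *)
  pose e := c * (M - m) / 2 / L.
  have e0 : 0 < e by rewrite !divr_gt0.
  have eL : e * L = c * (M - m) / 2 by rewrite /e divfK// gt_eqF.
  have small : 2 * e * E <= M - m.
    rewrite -(ler_pM2l c_gt0); have : e * (2 * c * E) <= e * L.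
      by rewrite ler_pM2l// /L; lra.
    by rewrite eL; lra.
  have [t0 t00 yt0] := eventually e e0.
  have [s [b [s0 t0s sb UK arr]]] := windows t0.
  have b0 := le_trans s0 sb.
  have [j jtop _] := topj b b0; have [k kbot _] := botj b b0.
  have Mj := Mtop _ jtop; have km := mbot _ kbot.
  have jk : j != k.
    apply/eqP => jkE; move: Mj; rewrite jkE => /le_trans /(_ km).
    by rewrite leNgt ltmM.
  have yM l : y l s <= M + e by have [] := yt0 s l t0s.
  have ym l : m - e <= y l s by have [] := yt0 s l t0s.
  have : c * (M - m) <= e * L.
    have [cU|cU] := arr j k jk.
      exact: (window_gap sol s0 sb UK e0 c_gt0 yM ym Mj km cU).
    (* For the opposite arrow, a change of sign exchanges top and bottom. *)
    have -> : M - m = - m - - M by rewrite opprK addrC.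
    apply: (window_gap (scalar_solution_opp sol) s0 sb UK e0 c_gt0
      (M := - m) (m := - M) (j := k) (k := j)) => //.
    - by move=> l; have := ym l; lra.
    - by move=> l; have := yM l; lra.
    - by rewrite lerN2.
    - by rewrite lerN2.
    - by rewrite opprK addrC.
  by rewrite eL; lra.
exists M => j; apply/cvgrPdist_le => e e0.
have [t0 _ yt0] := eventually e e0.
near=> t; have [] := yt0 t j.
  by near: t; apply: nbhs_pinfty_ge; exact: num_real.
by rewrite -MmE ler_distl; lra.
Unshelve. all: by end_near. Qed.

End scalar.

(** * Reduction to coordinates *)

Lemma entry_normr_le {R : realFieldType} {d : nat} (v : 'rV[R]_d) i :
  `|v 0 i| <= `|v|.
Proof.
rewrite [leRHS]/Num.Def.normr/= mx_normrE.
exact: (le_bigmax _ (fun ij : 'I_1 * 'I_d => `|v ij.1 ij.2|) (0, i)).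
Qed.

Lemma caratheodory_coordinate {R : realType} {N d : nat}
    (u : 'I_N -> 'I_N -> R -> R) (x : 'I_N -> R -> 'rV[R]_d) (i : 'I_d) :
  caratheodory_solution u x -> scalar_solution u (fun j t => x j t 0 i).
Proof.
move=> sol; split => [j b b0|j]; have [acx dx] := sol j.
  apply: (ac_dominated (I := unit) (C := 1) (F := fun=> x j)) => [_|s t _ _ _].
    exact: acx.
  rewrite big_const card_unit/= addr0 mul1r.
  by have := entry_normr_le (x j t - x j s) i; rewrite !mxE.
apply/completed_negligible; apply: negligibleS dx => t /= nd dx; apply: nd => t0.
have [dxt dxE] := dx t0; apply: DeriveDef.
  by move/derivable_mxP : dxt; apply.
have := derive_mx dxt; rewrite dxE => /matrixP /(_ 0 i).
by rewrite !mxE summxE => <-; apply: eq_bigr => k _; rewrite !mxE.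
Qed.

Lemma cvg_row {R : realType} {d : nat} (x : R -> 'rV[R]_d) (l : 'I_d -> R) :
  (forall i, x t 0 i @[t --> +oo] --> l i) ->
  x t @[t --> +oo] --> \row_i l i.
Proof.
move=> xl; apply/cvgrPdist_le => e e0; near=> t.
rewrite [leLHS]/Num.Def.normr/= mx_normrE (bigmax_le _ (ltW e0))//= => -[k i] _ /=.
rewrite ord1 !mxE; move: i {k}; near: t; apply: filter_forall => i.
by move/cvgrPdist_le : (xl i); exact.
Unshelve. all: by end_near. Qed.

(** * From weak-star convergence to uniform late windows *)

Theorem theorem7 (R : realType) (N d : nat) (hN : (0 < N)%N) (hd : (0 < d)%N)
  (u ustar : 'I_N -> 'I_N -> R -> R)
  (u_ge0 : forall (j k : 'I_N) (t : R), 0 <= t -> 0 <= u j k t)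
  (ustar_ge0 : forall (j k : 'I_N) (t : R), 0 <= t -> 0 <= ustar j k t)
  (u_int : forall j k : 'I_N, integrable_on_compacts (u j k))
  (ustar_int : forall j k : 'I_N, integrable_on_compacts (ustar j k))
  (t_ : nat -> R)
  (t_ge0 : forall n : nat, 0 <= t_ n)
  (t_cvg : t_ n @[n --> \oo] --> +oo)
  (u_cvg : forall j k : 'I_N,
     weak_star_cvg (fun (n : nat) (t : R) => u j k (t_ n + t)) (ustar j k))
  (semicomplete : forall j k : 'I_N, j != k ->
     arrow ustar j k \/ arrow ustar k j)
  (x0 : 'I_N -> 'rV[R]_d) (x : 'I_N -> R -> 'rV[R]_d)
  (x_init : forall j : 'I_N, x j 0 = x0 j)
  (x_sol : caratheodory_solution u x) :
  converges_to_consensus x.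
Proof.
have [U UP] := choice (fun j =>
  let: existT f fP := choice (fun k =>
    completed_primitive (u_ge0 j k) (u_int j k)) in ex_intro _ f fP).
have [V VP] := choice (fun j =>
  let: existT f fP := choice (fun k =>
    completed_primitive (ustar_ge0 j k) (ustar_int j k)) in ex_intro _ f fP).
have acU j k b : 0 <= b -> absolutely_continuous 0 b (U j k).
  by have [acU _ _ _] := UP j k; exact: acU.
have dU j k : {ae @lebesgue_measure R, forall t : R, 0 < t ->
    is_derive t 1 (U j k) (u j k t)}.
  by have [] := UP j k.
have U_int j k c T : 0 <= c -> 0 <= T ->
    \int[@completed_lebesgue_measure R]_(s in `[0, T]) u j k (c + s) =
    U j k (c + T) - U j k c.
  by move=> c0 T0; have [_ _ UB _] := UP j k; rewrite /Rintegral UB.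
have V_int j k c T : 0 <= c -> 0 <= T ->
    \int[@completed_lebesgue_measure R]_(s in `[0, T]) ustar j k (c + s) =
    V j k (c + T) - V j k c.
  by move=> c0 T0; have [_ _ VB _] := VP j k; rewrite /Rintegral VB.
have mono (f F : R -> R) a b : (forall t, 0 <= t -> 0 <= f t) ->
    (forall c T, 0 <= c -> 0 <= T ->
       \int[@completed_lebesgue_measure R]_(s in `[0, T]) f (c + s) =
       F (c + T) - F c) ->
    0 <= a -> a <= b -> F a <= F b.
  move=> f0 fF a0 ab; rewrite -subr_ge0 -{1}(subrKC a b) -fF ?subr_ge0//.
  apply: Rintegral_ge0 => s; rewrite /= in_itv/= => /andP[s0 _].
  by rewrite f0// addr_ge0.
have U_mono j k a b : 0 <= a -> a <= b -> U j k a <= U j k b.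
  exact: (mono _ _ _ _ (u_ge0 j k) (U_int j k)).
have V_mono j k a b : 0 <= a -> a <= b -> V j k a <= V j k b.
  exact: (mono _ _ _ _ (ustar_ge0 j k) (V_int j k)).
(* For each arrow, a time by which it has carried positive limit weight; the maximum [T] of these
   times is one window length for all pairs. *)
have /choice[T_ TP] : forall jk : 'I_N * 'I_N, exists T, 0 <= T /\
    (arrow ustar jk.1 jk.2 -> V jk.1 jk.2 0 < V jk.1 jk.2 T).
  move=> [j k] /=; have [jk|njk] := pselect (arrow ustar j k).
    by have [_ _ _ /(_ jk)[T T0 VT]] := VP j k; exists T.
  by exists 0.
pose T := \big[Num.max/0]_jk T_ jk.
have T0 : 0 <= T by exact: bigmax_ge_id.
pose w j k := V j k T - V j k 0.
have w0 j k : 0 <= w j k by rewrite subr_ge0 V_mono.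
(* Smallest positive limit weight on [[0, T]], or 1 if that is smaller or no weight is positive. *)
pose c := \big[Num.min/1]_(jk | 0 < w jk.1 jk.2) w jk.1 jk.2.
have c0 : 0 < c by apply/bigmin_gtP; split.
have arrow_w j k : arrow ustar j k -> c <= w j k.
  move=> jk; apply: (@bigmin_le_cond _ _ _ _ (j, k)
    (fun jk => 0 < w jk.1 jk.2) (fun jk => w jk.1 jk.2)) => /=.
  have [T_0 /(_ jk) VT] := TP (j, k).
  rewrite subr_gt0 (lt_le_trans VT)// V_mono//.
  exact: (le_bigmax _ T_ (j, k)).
(* Summing over [j] as well gives one bound for all rows; the [+ 1] absorbs the error of the
   approximation. *)
pose K := \sum_j \sum_k (w j k + 1).
have w_cvg j k : U j k (t_ n + T) - U j k (t_ n) @[n --> \oo] --> w j k.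
  have := u_cvg j k 0 T (lexx 0) T0.
  rewrite (_ : (fun n => _) =
    (fun n => U j k (t_ n + T) - U j k (t_ n))); last first.
    by apply/funext => n; rewrite U_int.
  rewrite (_ : \int[_]_(s in _) _ = w j k)//.
  rewrite /w -[in V j k T](add0r T) -V_int//; apply: eq_Rintegral => s _.
  by rewrite add0r.
have windows t0 : exists s b, [/\ 0 <= s, t0 <= s, s <= b,
    forall j, \sum_k (U j k b - U j k s) <= K &
    forall j k, j != k ->
      c / 2 <= U j k b - U j k s \/ c / 2 <= U k j b - U k j s].
  (* An error below [c / 2] keeps at least half of [c] on every arrow; an error below 1 keeps the
     row sums under [K]. *)
  have : \forall n \near \oo, forall j k,
      `|w j k - (U j k (t_ n + T) - U j k (t_ n))| < Num.min (c / 2) 1.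
    apply: filter_forall => j; apply: filter_forall => k.
    move/cvgrPdist_lt : (w_cvg j k); apply.
    by rewrite lt_min ltr01 andbT divr_gt0.
  have : \forall n \near \oo, t0 <= t_ n by move/cvgryPge : t_cvg; exact.
  move=> h1 h2; have [n [tn wn]] : exists n, t0 <= t_ n /\ forall j k,
      `|w j k - (U j k (t_ n + T) - U j k (t_ n))| < Num.min (c / 2) 1.
    by near \oo => n; exists n; split; [near: n; exact: h1|near: n; exact: h2].
  exists (t_ n), (t_ n + T); split; rewrite ?lerDl//.
    move=> j; apply: (@le_trans _ _ (\sum_k (w j k + 1))).
      apply: ler_sum => k _; have := wn j k; rewrite lt_min => /andP[_].
      by rewrite ltr_distl => /andP[+ _]; lra.
    rewrite /K [leRHS](bigD1 j)//= lerDl.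
    by apply: sumr_ge0 => i _; apply: sumr_ge0 => k _; rewrite addr_ge0.
  have near_w j k : c <= w j k -> c / 2 <= U j k (t_ n + T) - U j k (t_ n).
    have := wn j k; rewrite lt_min => /andP[+ _].
    by rewrite ltr_distl => /andP[_]; lra.
  by move=> j k /semicomplete[/arrow_w|/arrow_w] /near_w; [left|right].
have c20 : 0 < c / 2 by rewrite divr_gt0.
have /choice[l lP] : forall i : 'I_d, exists l : R, forall j : 'I_N,
    x j t 0 i @[t --> +oo] --> l.
  move=> i; have sol := caratheodory_coordinate i x_sol.
  exact: (scalar_consensus u_ge0 acU dU U_mono hN c20 windows sol).
by exists (\row_i l i) => j; apply: cvg_row => i; exact: lP.
Unshelve. all: by end_near. Qed.
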